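(* Let $w, w' \in W_a$. Then the alcoves $A_w$ and $A_{w'}$ have the same orientation if and only if the following two conditions are both satisfied: (i) the Shi vectors $\iota(w)$ and $\iota(w')$ lie in the same irreducible component of the Shi variety $\widehat{X}_{W_a}$; (ii) the sections $\mathsf{s}_w$ and $\mathsf{s}_{w'}$ define the same element in $H^1(W,\mathbb{Z}\Phi)$.
   Context: Root system and groups. $V$ is a Euclidean space with inner product $\langle -,-\rangle$, $\Phi\subset V$ is an irreducible (reduced) crystallographic root system spanning $V$, with simple system $\Delta=\{\alpha_1,\dots,\alpha_n\}$ and positive roots $\Phi^+$, $m=|\Phi^+|$. For $\alpha\in\Phi$, $\alpha^\vee=2\alpha/\langle\alpha,\alpha\rangle$. For $\beta\in\Phi^+$ write $\beta^\vee=c_1\alpha_1^\vee+\cdots+c_n\alpha_n^\vee$ with $c_i\in\mathbb{Z}_{\ge 0}$, and set $\mathsf{h}(\beta^\vee)=c_1+\cdots+c_n$. $W$ is the Weyl group, generated by the reflections $s_i=s_{\alpha_i}$. For $x\in V$, $\tau_x$ is the translation by $x$. For $\alpha\in\Phi$, $k\in\mathbb{Z}$, $s_{\alpha,k}(x)=x-(\langle\alpha^\vee,x\rangle-k)\alpha$; the affine Weyl group $W_a$ is generated by all $s_{\alpha,k}$, and $W_a=\mathbb{Z}\Phi\rtimes W$, where $\mathbb{Z}\Phi$ (the root lattice) is identified with its group of translations. Alcoves and Shi vectors. Put $H_{\alpha,k}=\{x\in V: \langle x,\alpha^\vee\rangle=k\}$ and $H^1_{\alpha,k}=\{x\in V: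 k<\langle x,\alpha^\vee\rangle<k+1\}$. Alcoves are the connected components of $V\setminus\bigcup_{\alpha\in\Phi^+,k\in\mathbb{Z}}H_{\alpha,k}$. Let $A_e=\bigcap_{\alpha\in\Phi^+}H^1_{\alpha,0}$ and $A_w=wA_e$ for $w\in W_a$. The Shi coefficients $k(w,\alpha)\in\mathbb{Z}$ are defined by $A_w=\bigcap_{\alpha\in\Phi^+}H^1_{\alpha,k(w,\alpha)}$, and the Shi vector of $w$ is $\iota(w)=(k(w,\alpha))_{\alpha\in\Phi^+}$. Orientation. $A_w$ and $A_{w'}$ have the same orientation if there is $x\in\mathbb{Z}\Phi$ with $w'=\tau_xw$. Shi variety. For $\beta\in\Phi^+$ with $\beta^\vee=\sum_i c_i\alpha_i^\vee$, set $P_\beta=\sum_i c_iX_{\alpha_i}$. A vector $\lambda=(\lambda_\beta)_{\beta\in\Phi^+}$ of integers is admissible if $0\le\lambda_\beta\le \mathsf{h}(\beta^\vee)-1$ for all $\beta\in\Phi^+$ (so $\lambda_\beta=0$ for $\beta\in\Delta$). It is admitted if in addition, for all $\alpha,\beta\in\Phi^+$ with $\alpha+\beta\in\Phi^+$, $$\|\alpha\|^2\lambda_\alpha+\|\beta\|^2\lambda_\beta+1\le\|\alpha+\beta\|^2(\lambda_{\alpha+\beta}+1)\le\|\alpha\|^2\lambda_\alpha+\|\beta\|^2\lambda_\beta+\|\alpha\|^2+\|\beta\|^2+\|\alpha+\beta\|^2-1.$$ For admitted $\lambda$, $X_{W_a}[\lambda]\subset\mathbb{R}^{\Phi^+}=\mathbb{R}^m$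 is the affine subspace of points $(x_\beta)_{\beta\in\Phi^+}$ with $x_\beta=P_\beta(x_{\alpha_1},\dots,x_{\alpha_n})+\lambda_\beta$ for all $\beta\in\Phi^+$. The Shi variety is the disjoint union $\widehat{X}_{W_a}=\bigsqcup_{\lambda\text{ admitted}}X_{W_a}[\lambda]$; its irreducible components are the $X_{W_a}[\lambda]$, and $\iota$ is a bijection from $W_a$ onto the integral points of $\widehat{X}_{W_a}$. Sections and $H^1$. A section is a group morphism $\mathsf{s}:W\to\mathbb{Z}\Phi\rtimes W=W_a$ with $\pi\circ\mathsf{s}=\mathrm{id}_W$, where $\pi:\mathbb{Z}\Phi\rtimes W\to W$ is the projection. Two sections $\mathsf{s},\mathsf{s}'$ are $\mathbb{Z}\Phi$-conjugate if there is $z\in\mathbb{Z}\Phi$ with $\mathsf{s}'(g)=\tau_z\mathsf{s}(g)\tau_{-z}$ for all $g\in W$. The set of sections up to $\mathbb{Z}\Phi$-conjugacy is identified with $H^1(W,\mathbb{Z}\Phi)$ (a section $\mathsf{s}(g)=\tau_{f(g)}g$ corresponds to the class of the 1-cocycle $f$), so two sections define the same element of $H^1(W,\mathbb{Z}\Phi)$ iff they are $\mathbb{Z}\Phi$-conjugate. For $w\in W_a$, $\mathsf{s}_w$ is the section determined by $\mathsf{s}_w(s_i)=\tau_{k(w,\alpha_i)\alpha_i}s_i$ for $i=1,\dots,n$ (for any integers $k_i$, the assignment $s_i\mapsto\tau_{k_i\alpha_i}s_i$ extends to a unique section).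
   Formalization: The inner product is assumed scaled so that every root has squared norm at least 1; the constants +1 and -1 in the definition of admitted vectors require this (for A_2 with squared norm 1/2 no vector is admitted, so the Shi variety is empty and the claim fails). *)

(* Defs.v *)
From HB Require Import structures.
From mathcomp Require Import all_boot all_order all_algebra finmap.
From mathcomp Require Import boolp classical_sets reals.
From mathcomp Require mpoly.

Set Implicit Arguments.
Unset Strict Implicit.
Unset Printing Implicit Defensive.

Import Order.TTheory GRing.Theory Num.Theory.

Local Open Scope classical_set_scope.
Local Open Scope ring_scope.

Section Zariski.
Context {R : realType} {I : finType}.
Implicit Types X C Z : set {ffun I -> R}.

(* Polynomials in the coordinates [x i]: the variables are numbered by
   [enum_rank], and variable number [j] is evaluated at [x (enum_val j)]. *)
Definition zariski_closed Z : Prop :=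
  exists P : set (mpoly.mpoly #|I| R),
    Z = [set x | forall p, P p ->
           mpoly.meval (fun j : 'I_#|I| => x (enum_val j)) p = 0].

Definition irreducible_set C : Prop :=
  C !=set0 /\
  forall Z1 Z2, zariski_closed Z1 -> zariski_closed Z2 ->
    C `<=` Z1 `|` Z2 -> C `<=` Z1 \/ C `<=` Z2.

Definition irreducible_component X C : Prop :=
  [/\ C `<=` X, irreducible_set C &
      forall C', irreducible_set C' -> C `<=` C' -> C' `<=` X -> C' = C].

End Zariski.

Section Reflections.
Context {R : realType} {V : vectType R} (dot : {dot V for idfun}).
Implicit Types (a x : V) (k : int).

Definition coroot a : V := (2 / dot a a) *: a.

Definition affine_reflection a k : V -> V :=
  fun x => x - (dot (coroot a) x - k%:~R) *: a.

Definition reflection a : V -> V := affine_reflection a 0.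

Definition translation x : V -> V := fun y => x + y.

Definition strip a k : set V :=
  [set x | k%:~R < dot x (coroot a) < k%:~R + 1].

End Reflections.

Record root_system {R : realType} {V : vectType R} (dot : {dot V for idfun}) :=
RootSystem {
  roots : {fset V};
  simple : (\dim {:V}).-tuple V;
  roots_span : <<enum_fset roots>>%VS = fullv;
  roots_neq0 : 0 \notin roots;
  roots_reflection : forall a b, a \in roots -> b \in roots ->
    reflection dot a b \in roots;
  roots_crystallographic : forall a b, a \in roots -> b \in roots ->
    dot (coroot dot a) b \is a Num.int;
  roots_reduced : forall a (c : R), a \in roots -> c *: a \in roots ->
    c = 1 \/ c = -1;
  roots_nonempty : roots != fset0%fset;
  roots_irreducible : forall A : {fset V}, (A `<=` roots)%fset ->
    (forall a b, a \in A -> b \in (roots `\` A)%fset -> dot a b = 0) ->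
    A = fset0%fset \/ A = roots;
  simple_root : forall i, tnth simple i \in roots;
  simple_basis : basis_of fullv simple;
  simple_sign : forall b, b \in roots ->
    (forall i, 0 <= coord simple i b) \/ (forall i, coord simple i b <= 0)
}.

Section RootSystem.
Context {R : realType} {V : vectType R} {dot : {dot V for idfun}}.
Variable D : root_system dot.

Definition rank : nat := \dim {:V}.

Definition pos_roots : {fset V} :=
  [fset b in roots D | [forall i, 0 <= coord (simple D) i b]]%fset.

Lemma simple_pos_root (i : 'I_rank) : tnth (simple D) i \in pos_roots.
Proof.
rewrite !inE /= simple_root /=; apply/forallP => j.
rewrite (tnth_nth 0) coord_free ?ler0n //.
exact: basis_free (simple_basis D).
Qed.

Definition simple_pos (i : 'I_rank) : pos_roots := FSetSub (simple_pos_root i).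

(* The coefficients c_i of b^vee on the simple coroots; they are integers for
   every root b, but are taken here in R. *)
Definition coroot_coef (b : V) (i : 'I_rank) : R :=
  coord (map_tuple (coroot dot) (simple D)) i (coroot dot b).

Definition coroot_height (b : V) : R := \sum_(i < rank) coroot_coef b i.

Definition root_lattice : set V :=
  [set x | inIntSpan (in_tuple (enum_fset (roots D))) x].

(* Only used when S is a set of reflections: being involutions, they generate
   the same group as a monoid and as a group. *)
Inductive generated_by (S : set (V -> V)) : set (V -> V) :=
| generated_id : generated_by S idfun
| generated_comp f g : S f -> generated_by S g -> generated_by S (f \o g).

Definition simple_reflection (i : 'I_rank) : V -> V :=
  reflection dot (tnth (simple D) i).

Definition weyl_group : set (V -> V) := generated_by (range simple_reflection).

Definition affine_weyl_group : set (V -> V) :=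
  generated_by [set f | exists2 a, a \in roots D &
                        exists k : int, f = affine_reflection dot a k].

Definition fundamental_alcove : set V :=
  \bigcap_(a in [set: pos_roots]) strip dot (val a) 0.

Definition alcove (w : V -> V) : set V := w @` fundamental_alcove.

(* The unique k with this property, if w is in the affine Weyl group. *)
Definition shi_vector (w : V -> V) : {ffun pos_roots -> int} :=
  xget [ffun=> 0] [set k : {ffun pos_roots -> int} |
    alcove w = \bigcap_(a in [set: pos_roots]) strip dot (val a) (k a)].

Definition shi_point (w : V -> V) : {ffun pos_roots -> R} :=
  [ffun a => (shi_vector w a)%:~R].

Definition same_orientation (w w' : V -> V) : Prop :=
  exists2 x, root_lattice x & w' = translation x \o w.

Definition admissible (l : {ffun pos_roots -> int}) : Prop :=
  forall b : pos_roots, 0 <= l b /\ (l b)%:~R <= coroot_height (val b) - 1.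

(* The constants +1 and -1 only express strict inequalities if the scale of the
   inner product is such that every root has squared norm at least 1 (usually
   short roots have squared norm 1); otherwise, for instance, type A_2 has no
   admitted vector. *)
Definition admitted (l : {ffun pos_roots -> int}) : Prop :=
  admissible l /\
  forall a b c : pos_roots, val c = val a + val b ->
    let na := dot (val a) (val a) in
    let nb := dot (val b) (val b) in
    let nc := dot (val c) (val c) in
    na * (l a)%:~R + nb * (l b)%:~R + 1 <= nc * ((l c)%:~R + 1)
      <= na * (l a)%:~R + nb * (l b)%:~R + na + nb + nc - 1.

Definition shi_linear_form (b : pos_roots) (x : {ffun pos_roots -> R}) : R :=
  \sum_(i < rank) coroot_coef (val b) i * x (simple_pos i).

Definition shi_subspace (l : {ffun pos_roots -> int})
    : set {ffun pos_roots -> R} :=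
  [set x : {ffun pos_roots -> R} |
     forall b, x b = shi_linear_form b x + (l b)%:~R].

Definition shi_variety : set {ffun pos_roots -> R} :=
  \bigcup_(l in [set l | admitted l]) shi_subspace l.

(* The projection of an element tau_x g of the affine Weyl group to g. *)
Definition linear_part (f : V -> V) : V -> V := fun x => f x - f 0.

(* Functions on the Weyl group (sections, cocycles) are total functions on
   [V -> V] whose values outside the Weyl group are irrelevant. *)
Definition is_section (s : (V -> V) -> (V -> V)) : Prop :=
  [/\ forall g, weyl_group g -> affine_weyl_group (s g),
      forall g h, weyl_group g -> weyl_group h -> s (g \o h) = s g \o s h &
      forall g, weyl_group g -> linear_part (s g) = g].

(* On the Weyl group, the unique section with these values on the s_i. *)
Definition shi_section (w : V -> V) : (V -> V) -> (V -> V) :=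
  xget (idfun : (V -> V) -> (V -> V)) [set s | is_section s /\
    forall i, s (simple_reflection i) =
      translation ((shi_vector w (simple_pos i))%:~R *: tnth (simple D) i)
        \o simple_reflection i].

Definition cocycle (f : (V -> V) -> V) : Prop :=
  (forall g, weyl_group g -> root_lattice (f g)) /\
  (forall g h, weyl_group g -> weyl_group h -> f (g \o h) = f g + g (f h)).

Definition cohomologous (f f' : (V -> V) -> V) : Prop :=
  exists2 z, root_lattice z &
    forall g, weyl_group g -> f' g - f g = z - g z.

(* The element of H^1(W, ZPhi) defined by a cocycle. *)
Definition cohomology_class (f : (V -> V) -> V) : set ((V -> V) -> V) :=
  [set f' | cocycle f' /\ cohomologous f f'].

(* The cocycle f of the section s(g) = tau_(f g) g. *)
Definition section_cocycle (s : (V -> V) -> (V -> V)) : (V -> V) -> V :=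
  fun g => s g 0.

End RootSystem.

Definition normalized {R : realType} {V : vectType R} {dot : {dot V for idfun}}
    (D : root_system dot) : Prop :=
  forall a, a \in roots D -> 1 <= dot a a.

Arguments shi_variety {R V dot} D _.

(* Main.v *)
(** An element [w] of the affine Weyl group has [k(w, b) = floor <y, b^v>] for any
    [y] in the alcove [A_w], so translating [w] by [x] adds [<x, b^v>] to the
    Shi vector and preserves [l_b = k_b - P_b(k)], that is, the subspace [X[l]].
    These subspaces are affine and there are finitely many of them, so they are
    the irreducible components of the Shi variety.

    Choose [z] in [V] with [<z, a_i^v> = k(w, a_i)] for every simple root [a_i].
    The section of [w] is conjugation by the translation [tau_z], so
    the sections of [w] and [w'] are conjugate under the root lattice iff
    [x = z' - z] is in it. If moreover the two Shi vectors lie in the same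
    [X[l]], then [tau_x w] and [w'] have the same Shi vector, hence the same
    alcove, and they are equal because the action on alcoves is free: an element
    [tau_y g] that stabilizes the fundamental alcove has [<y, b^v> <= 1] for all
    roots [b], which forces [y = 0] in the root lattice, and then [g] preserves
    the positive roots. *)
From mathcomp Require Import all_boot all_order all_algebra finmap.
From mathcomp Require Import boolp classical_sets reals.
From mathcomp Require Import lra ring zify.
From mathcomp Require mpoly.
Require Import Defs.
Import -(notations) mpoly.

Set Implicit Arguments.
Unset Strict Implicit.
Unset Printing Implicit Defensive.

Import Order.TTheory GRing.Theory Num.Theory.
Local Open Scope classical_set_scope.
Local Open Scope ring_scope.

(** * Zariski closed sets and irreducibility in a real affine space *)

Section Zariski.
Context {R : realType} {I : finType}.
Implicit Types (x y : {ffun I -> R}) (p : mpoly.mpoly #|I| R) (Z C : set {ffun I -> R}).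

Definition mpoly_eval x p : R := mpoly.meval (fun j : 'I_#|I| => x (enum_val j)) p.

Lemma zariski_closed0 : zariski_closed (@set0 {ffun I -> R}).
Proof.
exists [set q : mpoly.mpoly #|I| R | q = 1]; apply/seteqP; split=> // x /(_ _ erefl).
by rewrite mpoly.meval1 => /eqP; rewrite oner_eq0.
Qed.

(** The products of one equation from each family cut out the union, since a field has no zero
    divisors. *)
Lemma zariski_closedU Z1 Z2 :
  zariski_closed Z1 -> zariski_closed Z2 -> zariski_closed (Z1 `|` Z2).
Proof.
move=> [P1 ->] [P2 ->]; exists [set q | exists p1 p2, [/\ P1 p1, P2 p2 & q = p1 * p2]].
apply/seteqP; split=> x /=.
  by move=> xZ q [p1 [p2 [Pp1 Pp2 ->]]]; rewrite mpoly.mevalM;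
    case: xZ => /(_ _ ltac:(eassumption)) ->; rewrite ?mul0r ?mulr0.
move=> xZ; apply: contrapT => /not_orP[/existsNP[p1 /not_implyP[Pp1 /eqP n1]]].
move=> /existsNP[p2 /not_implyP[Pp2 /eqP n2]].
have /eqP := xZ (p1 * p2) (ex_intro _ p1 (ex_intro _ p2 (And3 Pp1 Pp2 erefl))).
by rewrite mpoly.mevalM mulf_eq0 (negPf n1) (negPf n2).
Qed.

Lemma zariski_closed_bigsetU (T : Type) (s : seq T) (F : T -> set {ffun I -> R}) :
  (forall t, zariski_closed (F t)) ->
  zariski_closed (\big[setU/set0]_(t <- s) F t).
Proof.
move=> Fc; elim/big_rec: _ => [|t Z _ Zc]; first exact: zariski_closed0.
exact: zariski_closedU.
Qed.

(** Irreducibility is iterated along the list; a point of [C] rules out the empty union. *)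
Lemma irreducible_bigsetU (T : Type) (s : seq T) (F : T -> set {ffun I -> R}) C :
  (forall t, zariski_closed (F t)) -> irreducible_set C ->
  C `<=` \big[setU/set0]_(t <- s) F t -> exists t, C `<=` F t.
Proof.
move=> Fc [[x Cx] Cirr]; elim: s => [|t s IHs].
  by rewrite big_nil => /(_ x Cx).
rewrite big_cons => /(Cirr _ _ (Fc t) (zariski_closed_bigsetU s Fc)).
by case=> [?|/IHs//]; exists t.
Qed.

(** Reduces vanishing questions on an affine subspace to polynomials in one variable. *)
Lemma mpoly_eval_line x y p :
  exists q : {poly R}, forall t, q.[t] = mpoly_eval [ffun i => x i + t * (y i - x i)] p.
Proof.
exists (\sum_(m <- mpoly.msupp p) (mpoly.mcoeff m p)%:P *
  \prod_j ((x (enum_val j))%:P + 'X * (y (enum_val j) - x (enum_val j))%:P) ^+ m j).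
move=> t; rewrite /mpoly_eval mpoly.mevalE horner_sum; apply: eq_bigr => m _.
rewrite hornerM hornerC horner_prod; congr (_ * _); apply: eq_bigr => j _.
by rewrite horner_exp ffunE !hornerE.
Qed.

Lemma poly_eval0 (q : {poly R}) : (forall t, q.[t] = 0) -> q = 0.
Proof.
move=> q0; apply/eqP/negPn/negP => qn0.
(* A nonzero [q] has fewer than [size q] roots, but the [size q] numbers 0, 1, 2, ... would all be
   roots. *)
have := max_poly_roots (rs := [seq (i%:R : R) | i <- iota 0 (size q)]) qn0.
rewrite size_map size_iota ltnn => H; suff: false by []; apply: H.
  by apply/allP => t _; apply/rootP.
by rewrite map_inj_uniq ?iota_uniq// => i j /eqP; rewrite eqr_nat => /eqP.
Qed.

(** Suppose [Z1] and [Z2] cover [C], with [x] in [C] outside [Z1] and [y] in [C] outside [Z2].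
    Restricted to the line through [x] and [y], an equation of [Z1] failing at [x] and one of [Z2]
    failing at [y] have product zero, so one of them is zero on the line, against its value at t = 0
    or t = 1. *)
Lemma line_irreducible C : C !=set0 ->
  (forall x y t, C x -> C y -> C [ffun i => x i + t * (y i - x i)]) ->
  irreducible_set C.
Proof.
move=> C0 Cline; split=> // Z1 Z2 [P1 ->] [P2 ->] CZ.
apply: contrapT => /not_orP[/existsNP[x /not_implyP[Cx]] + /existsNP[y /not_implyP[Cy]]].
move=> /existsNP[p1 /not_implyP[Pp1 /eqP n1]] /existsNP[p2 /not_implyP[Pp2 /eqP n2]].
have [q1 q1E] := mpoly_eval_line x y p1; have [q2 q2E] := mpoly_eval_line x y p2.
have /eqP : q1 * q2 = 0.
  apply: poly_eval0 => t; rewrite hornerM q1E q2E.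
  by case: (CZ _ (Cline x y t Cx Cy)) => /(_ _ ltac:(eassumption));
    rewrite /mpoly_eval => ->; rewrite ?mul0r ?mulr0.
rewrite mulf_eq0 => /orP[]/eqP q0.
  case/eqP: n1; have := q1E 0; rewrite q0 horner0 => ->.
  by congr mpoly_eval; apply/ffunP => i; rewrite ffunE mul0r addr0.
case/eqP: n2; have := q2E 1; rewrite q0 horner0 => ->.
by congr mpoly_eval; apply/ffunP => i; rewrite ffunE mul1r addrC subrK.
Qed.

Lemma affine_zariski_closed (J : finType) (c : {ffun J -> {ffun I -> R}}) (d : J -> R) :
  zariski_closed [set x : {ffun I -> R} | forall j, \sum_i c j i * x i = d j].
Proof.
pose q j := \sum_(k < #|I|) mpoly.mpolyC _ (c j (enum_val k)) *
  mpoly.mpolyX R (mpoly.mnm1 k) - mpoly.mpolyC #|I| (d j).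
have qE x j : mpoly_eval x (q j) = \sum_i c j i * x i - d j.
  rewrite /mpoly_eval /q mpoly.mevalB mpoly.mevalC raddf_sum /=; congr (_ - _).
  rewrite (reindex_onto (fun k : 'I_#|I| => enum_val k) enum_rank) /=; last first.
    by move=> i _; rewrite enum_rankK.
  apply: eq_big => [k|k _]; first by rewrite enum_valK eqxx.
  by rewrite mpoly.mevalM mpoly.mevalC mpoly.mevalXU.
exists (range q); apply/seteqP; split=> x /=.
  by move=> xd _ [j _ <-]; apply/eqP; rewrite [mpoly.meval _ _]qE xd subrr.
by move=> xd j; apply/eqP; rewrite -subr_eq0 -qE; apply/eqP/xd; exists j.
Qed.

End Zariski.

(** * Maps generated by a set under composition *)

Lemma generated_by_subset (R : realType) (V : vectType R) (S T : set (V -> V)) :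
  S `<=` generated_by T -> generated_by S `<=` generated_by T.
Proof.
move=> ST f; elim=> [|g h /ST + _]; first exact: generated_id.
elim=> [//|g1 g2 Tg1 _ IH /IH]; exact: generated_comp.
Qed.

Lemma generated_by_comp (R : realType) (V : vectType R) (S : set (V -> V)) f g :
  generated_by S f -> generated_by S g -> generated_by S (f \o g).
Proof. by elim=> [//|f1 f2 Sf1 _ IH /IH]; exact: generated_comp. Qed.

Lemma generated_by1 (R : realType) (V : vectType R) (S : set (V -> V)) f :
  S f -> generated_by S f.
Proof. move=> Sf; apply: (generated_comp Sf); exact: generated_id. Qed.

(** * Reflections and isometries of a Euclidean space *)

Section DotProduct.
Context {R : realType} {V : vectType R} (dot : {dot V for idfun}).
Implicit Types (a b x y : V).

Lemma dotC x y : dot x y = dot y x.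
Proof. by rewrite hermC /= expr0 mul1r. Qed.

Lemma dotDl x y z : dot (x + y) z = dot x z + dot y z. Proof. exact: linearDl. Qed.
Lemma dotDr x y z : dot x (y + z) = dot x y + dot x z. Proof. exact: linearDr. Qed.
Lemma dotBl x y z : dot (x - y) z = dot x z - dot y z. Proof. exact: linearBl. Qed.
Lemma dotBr x y z : dot x (y - z) = dot x y - dot x z. Proof. exact: linearBr. Qed.
Lemma dotNl x z : dot (- x) z = - dot x z. Proof. exact: linearNl. Qed.
Lemma dotNr x z : dot x (- z) = - dot x z. Proof. exact: linearNr. Qed.
Lemma dot0l z : dot 0 z = 0. Proof. exact: linear0l. Qed.
Lemma dotZl c x z : dot (c *: x) z = c * dot x z. Proof. exact: linearZl_LR. Qed.
Lemma dotZr c x z : dot x (c *: z) = c * dot x z.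
Proof. by rewrite dotC dotZl dotC. Qed.
Lemma dot_suml I r (P : pred I) E z :
  dot (\sum_(i <- r | P i) E i) z = \sum_(i <- r | P i) dot (E i) z.
Proof. exact: linear_sumlz. Qed.
Lemma dot_sumr I r (P : pred I) E z :
  dot z (\sum_(i <- r | P i) E i) = \sum_(i <- r | P i) dot z (E i).
Proof. exact: linear_sumr. Qed.

Lemma dot_gt0 x : x != 0 -> 0 < dot x x.
Proof. exact: neq0_dnorm_gt0. Qed.

Lemma dot_eq0 x : dot x x = 0 -> x = 0.
Proof. by apply: contra_eq => /dot_gt0; rewrite lt0r => /andP[]. Qed.

Lemma dot_coroot a x : dot x (coroot dot a) = 2 / dot a a * dot x a.
Proof. by rewrite dotZr. Qed.

Lemma dot_corootxx a : a != 0 -> dot a (coroot dot a) = 2.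
Proof. by move=> /dot_gt0 a0; rewrite dot_coroot mulfVK ?gt_eqF. Qed.

Lemma scale_coroot a : dot a a *: coroot dot a = 2 *: a.
Proof.
have [->|/dot_gt0 a0] := eqVneq a 0; first by rewrite dot0l scale0r scaler0.
by rewrite scalerA mulrC mulfVK ?gt_eqF.
Qed.

Lemma corootN a : coroot dot (- a) = - coroot dot a.
Proof. by rewrite /coroot dotNl dotNr opprK scalerN. Qed.

Lemma reflectionE a x : reflection dot a x = x - dot x (coroot dot a) *: a.
Proof. by rewrite /reflection /affine_reflection subr0 dotC. Qed.

Lemma reflection_self a : reflection dot a a = - a.
Proof.
rewrite reflectionE; have [->|/dot_corootxx->] := eqVneq a 0.
  by rewrite scaler0 subr0 oppr0.
by rewrite scaler_nat mulr2n opprD addrA subrr add0r.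
Qed.

Lemma reflectionN a : reflection dot (- a) = reflection dot a.
Proof.
by apply/funext => x; rewrite !reflectionE corootN dotNr scalerN scaleNr opprK.
Qed.

Lemma reflection_linear a : linear (reflection dot a).
Proof.
move=> c x y; rewrite !reflectionE dotDl dotZl scalerDl scalerBr scalerA.
by rewrite opprD addrACA.
Qed.

Lemma reflection_involutive a : involutive (reflection dot a).
Proof.
move=> x; rewrite !reflectionE dotBl dotZl.
have [->|/dot_corootxx->] := eqVneq a 0; first by rewrite !scaler0 !subr0.
rewrite -addrA -opprD -scalerDl.
by have -> : forall d : R, d + (d - d * 2) = 0; [move=> d; ring | rewrite scale0r subr0].
Qed.

Lemma reflection_isometry a x y : dot (reflection dot a x) (reflection dot a y) = dot x y.
Proof.
have [->|a0] := eqVneq a 0; first by rewrite !reflectionE !scaler0 !subr0.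
rewrite !reflectionE /coroot dotBl !dotBr !dotZl !dotZr (dotC a y).
by field; rewrite gt_eqF ?dot_gt0.
Qed.

Lemma affine_reflectionE a (k : int) :
  affine_reflection dot a k = translation (k%:~R *: a) \o reflection dot a.
Proof.
apply/funext => x; rewrite /= /translation reflectionE /affine_reflection dotC.
by rewrite scalerBl opprB addrCA.
Qed.

Definition isometry (g : V -> V) := linear g /\ forall x y, dot (g x) (g y) = dot x y.

Section Isometry.
Variables (g : V -> V) (giso : isometry g).

Lemma isometryD x y : g (x + y) = g x + g y.
Proof. by case: giso => gl _; rewrite -[x]scale1r gl !scale1r. Qed.
Lemma isometry0 : g 0 = 0.
Proof. by apply: (addrI (g 0)); rewrite -isometryD !addr0. Qed.
Lemma isometryZ c x : g (c *: x) = c *: g x.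
Proof. by case: giso => gl _; have := gl c x 0; rewrite isometry0 !addr0. Qed.
Lemma isometryN x : g (- x) = - g x.
Proof. by rewrite -scaleN1r isometryZ scaleN1r. Qed.
Lemma isometryB x y : g (x - y) = g x - g y.
Proof. by rewrite isometryD isometryN. Qed.
Lemma isometry_coroot a : g (coroot dot a) = coroot dot (g a).
Proof. by rewrite /coroot isometryZ (proj2 giso). Qed.
Lemma isometry_reflection a x : g (reflection dot a x) = reflection dot (g a) (g x).
Proof. by rewrite !reflectionE isometryB isometryZ -isometry_coroot (proj2 giso). Qed.

End Isometry.

End DotProduct.

(** * Simple roots and positive roots *)

Section RootSystem.
Context {R : realType} {V : vectType R} {dot : {dot V for idfun}}.
Variable D : root_system dot.
Implicit Types (a b x y z : V) (g h : V -> V) (i j : 'I_(@rank R V)).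

Local Notation alpha i := (tnth (simple D) i).
Local Notation "x ^v" := (coroot dot x) (at level 2, format "x ^v").
Local Notation s_ := (simple_reflection D).

Lemma root_neq0 a : a \in roots D -> a != 0.
Proof. by apply: contraTneq => ->; exact: roots_neq0. Qed.

Lemma rootN a : a \in roots D -> - a \in roots D.
Proof. by move=> aD; rewrite -(reflection_self dot); exact: roots_reflection. Qed.

Lemma simple_neq0 i : alpha i != 0.
Proof. exact/root_neq0/simple_root. Qed.

Lemma coord_simple i j : coord (simple D) i (alpha j) = (j == i)%:R.
Proof. by rewrite (tnth_nth 0) coord_free //; exact: basis_free (simple_basis D). Qed.

Lemma simple_expansion x : x = \sum_i coord (simple D) i x *: alpha i.
Proof.
rewrite [LHS](coord_basis (simple_basis D) (memvf x)).
by apply: eq_bigr => i _; rewrite (tnth_nth 0).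
Qed.

Lemma dot_simple_ext x y : (forall i, dot x (alpha i) = dot y (alpha i)) -> x = y.
Proof.
move=> xy; apply/eqP; rewrite -subr_eq0; apply/eqP/(@dot_eq0 _ _ dot).
rewrite [in X in dot _ X](simple_expansion (x - y)) dot_sumr big1 // => i _.
by rewrite dotZr dotBl xy subrr mulr0.
Qed.

Lemma dot_simple_coroot_ext x y :
  (forall i, dot x (alpha i)^v = dot y (alpha i)^v) -> x = y.
Proof.
move=> xy; apply: dot_simple_ext => i; have := xy i; rewrite !dot_coroot.
apply: mulfI; rewrite mulf_neq0 ?pnatr_eq0 ?invr_eq0 //.
by rewrite gt_eqF // dot_gt0 // simple_neq0.
Qed.

(** The matrix pairing simple roots with simple coroots is invertible, because a vector orthogonal
    to all simple coroots is zero. *)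
Lemma dual_vector (k : 'I_(@rank R V) -> R) :
  exists z, forall i, dot z (alpha i)^v = k i.
Proof.
pose G : 'M[R]_(@rank R V) := \matrix_(j, i) dot (alpha j) (alpha i)^v.
have GE (r : 'rV[R]_(@rank R V)) i :
    (r *m G) 0 i = dot (\sum_j r 0 j *: alpha j) (alpha i)^v.
  by rewrite mxE dot_suml; apply: eq_bigr => j _; rewrite dotZl mxE.
have Gunit : G \in unitmx.
  rewrite -row_free_unit; apply: inj_row_free => r rG0.
  apply/rowP => i; rewrite mxE.
  have r0 : \sum_j r 0 j *: alpha j = 0.
    by apply: dot_simple_coroot_ext => j; rewrite dot0l -GE rG0 mxE.
  have := congr1 (coord (simple D) i) r0; rewrite linear0 linear_sum /=.
  rewrite (bigD1 i) //= linearZ /= coord_simple eqxx mulr1 big1 ?addr0 // => j ji.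
  by rewrite linearZ /= coord_simple (negPf ji) mulr0.
exists (\sum_j ((\row_i k i) *m invmx G) 0 j *: alpha j) => i.
by rewrite -GE mulmxKV // mxE.
Qed.

Lemma pos_rootsP b :
  b \in pos_roots D <-> b \in roots D /\ forall i, 0 <= coord (simple D) i b.
Proof.
rewrite !inE /=; split=> [/andP[bD /forallP]|[bD b0]]; first by split.
by rewrite bD; apply/forallP.
Qed.

Lemma pos_root b : b \in pos_roots D -> b \in roots D.
Proof. by case/pos_rootsP. Qed.

Lemma simple_pos_roots i : alpha i \in pos_roots D.
Proof. exact: simple_pos_root. Qed.

Lemma nonpos_root b : b \in roots D -> b \notin pos_roots D ->
  forall i, coord (simple D) i b <= 0.
Proof.
by move=> bD; case: (simple_sign bD) => // b0 /negP[]; apply/pos_rootsP.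
Qed.

Lemma opp_pos_roots b : b \in roots D -> b \notin pos_roots D -> - b \in pos_roots D.
Proof.
move=> bD /(nonpos_root bD) b0; apply/pos_rootsP; split; first exact: rootN.
by move=> i; rewrite linearN /= oppr_ge0.
Qed.

Lemma pos_rootsN b : b \in pos_roots D -> - b \notin pos_roots D.
Proof.
move=> /pos_rootsP[bD b0]; apply/negP => /pos_rootsP[_ nb0].
case/eqP: (root_neq0 bD); rewrite (simple_expansion b) big1 // => i _.
suff -> : coord (simple D) i b = 0 by rewrite scale0r.
by apply/eqP; rewrite eq_le b0 -oppr_ge0 -linearN /= nb0.
Qed.

Lemma simple_reflection_root i b : b \in roots D -> s_ i b \in roots D.
Proof. exact/roots_reflection/simple_root. Qed.

Lemma coord_simple_reflection i j b : j != i ->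
  coord (simple D) j (s_ i b) = coord (simple D) j b.
Proof.
move=> ji; rewrite /simple_reflection reflectionE linearB linearZ /= coord_simple.
by rewrite eq_sym (negPf ji) mulr0 subr0.
Qed.

(** A simple reflection changes only the coordinate [i]. If it made [b] negative, all other
    coordinates of [b] would vanish, and reducedness would leave only [b] = [alpha i]. *)
Lemma simple_reflection_pos i b : b \in pos_roots D -> b <> alpha i ->
  s_ i b \in pos_roots D.
Proof.
move=> /pos_rootsP[bD b0] bi; apply/negPn/negP.
move=> /(nonpos_root (simple_reflection_root i bD)) sb0; apply: bi.
have bE : b = coord (simple D) i b *: alpha i.
  rewrite [LHS]simple_expansion (bigD1 i) //= big1 ?addr0 // => j ji.
  suff -> : coord (simple D) j b = 0 by rewrite scale0r.
  by apply/eqP; rewrite eq_le b0 -(coord_simple_reflection _ ji) sb0.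
have := bD; rewrite bE => /(roots_reduced (simple_root D i))[->|bN].
  by rewrite scale1r.
by have := b0 i; rewrite bN oppr_ge0 ler10.
Qed.

(** Induction on the height of [b]. As <b, b> > 0 and [b] has nonnegative coordinates, some <b, a_i>
    is positive, and then [s_ i] lowers the height by <b, a_i^v>, a positive integer. *)
Lemma pos_root_ind (P : V -> Prop) :
  (forall i, P (alpha i)) ->
  (forall b i, b \in pos_roots D -> s_ i b \in pos_roots D -> P (s_ i b) -> P b) ->
  forall b, b \in pos_roots D -> P b.
Proof.
move=> P1 Ps; pose ht b := \sum_i coord (simple D) i b.
(* The height is only a real number here, so the induction runs on an integer bound for it. *)
suff H (n : nat) b : ht b < n%:R -> b \in pos_roots D -> P b.
  move=> b bD; apply: (H (Num.bound (ht b))) => //; apply: archi_boundP.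
  by apply: sumr_ge0 => i _; case/pos_rootsP: bD.
elim: n b => [|n IHn] b bn bD.
  case/pos_rootsP: bD => _ b0; suff : 0 <= ht b by rewrite leNgt bn.
  exact: sumr_ge0.
have [bD' b0] := (pos_rootsP b).1 bD.
have [i bi] : exists i, 0 < dot b (alpha i).
  apply: contrapT => /forallNP nb; have := dot_gt0 dot (root_neq0 bD').
  rewrite ltNge => /negP[]; rewrite [in X in dot _ X](simple_expansion b) dot_sumr.
  apply: sumr_le0 => i _; rewrite dotZr mulr_ge0_le0 // leNgt.
  by apply/negP; exact: nb.
have [->|/eqP bNi] := eqVneq b (alpha i); first exact: P1.
have sbD := simple_reflection_pos bD bNi.
apply: (Ps b i) => //; apply: IHn => //.
have htE : ht (s_ i b) = ht b - dot b (alpha i)^v.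
  rewrite /ht (bigD1 i) //= [in RHS](bigD1 i) //= /simple_reflection reflectionE.
  rewrite linearB linearZ /= coord_simple eqxx mulr1 addrAC; congr (_ + _ - _).
  by apply: eq_bigr => j ji; rewrite -reflectionE coord_simple_reflection.
have : dot b (alpha i)^v \is a Num.int.
  by rewrite dotC; exact: roots_crystallographic (simple_root D i) bD'.
case/intrP => k kE; have : 0 < dot b (alpha i)^v.
  by rewrite dot_coroot mulr_gt0 // divr_gt0 // dot_gt0 // simple_neq0.
rewrite htE kE ltr0z => k0; have : 1%:~R <= k%:~R :> R by rewrite ler_int -gtz0_ge1.
rewrite /= => k1.
by rewrite ltrBlDr (lt_le_trans bn) // -natr1 lerD2l.
Qed.

(** * Coefficients of coroots on the simple coroots *)

Lemma nth_simple_coroots i : (map_tuple (coroot dot) (simple D))`_i = (alpha i)^v.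
Proof. by rewrite -tnth_nth tnth_map. Qed.

Lemma simple_coroots_free : free (map_tuple (coroot dot) (simple D)).
Proof.
apply/freeP => k k0 i; have /freeP free_simple := basis_free (simple_basis D).
have /free_simple/(_ i)/eqP :
    \sum_i (k i * (2 / dot (alpha i) (alpha i))) *: (simple D)`_i = 0.
  rewrite -[RHS]k0; apply: eq_bigr => j _.
  by rewrite nth_simple_coroots /coroot scalerA -tnth_nth.
rewrite mulf_eq0 => /orP[/eqP//|].
by rewrite mulf_eq0 pnatr_eq0 invr_eq0 /= gt_eqF // dot_gt0 // simple_neq0.
Qed.

Lemma coroot_scaled_expansion b :
  b^v = (2 / dot b b) *: \sum_i coord (simple D) i b *: alpha i.
Proof. by rewrite -simple_expansion. Qed.

Lemma coroot_coefE b i :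
  coroot_coef D b i = coord (simple D) i b * (dot (alpha i) (alpha i) / dot b b).
Proof.
rewrite /coroot_coef; set X := map_tuple _ _.
suff -> : b^v = \sum_j (coord (simple D) j b * (dot (alpha j) (alpha j) / dot b b)) *: X`_j.
  by rewrite (coord_sum_free _ _ simple_coroots_free).
rewrite (coroot_scaled_expansion b) scaler_sumr.
apply: eq_bigr => j _; rewrite nth_simple_coroots !scalerA; congr (_ *: _).
have := dot_gt0 dot (simple_neq0 j); move: (dot (alpha j) _) => n n0.
have [->|b0] := eqVneq b 0; first by rewrite dot0l invr0 !(mulr0, mul0r).
by field; rewrite !gt_eqF // dot_gt0.
Qed.

Lemma coroot_expansion b : b \in roots D ->
  b^v = \sum_i coroot_coef D b i *: (alpha i)^v.
Proof.
move=> /root_neq0 /(dot_gt0 dot) b0.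
rewrite {1}(coroot_scaled_expansion b) scaler_sumr; apply: eq_bigr => j _.
rewrite coroot_coefE !scalerA; congr (_ *: _).
by field; rewrite !gt_eqF // dot_gt0 // simple_neq0.
Qed.

Lemma dot_coroot_expansion b x : b \in roots D ->
  dot x b^v = \sum_i coroot_coef D b i * dot x (alpha i)^v.
Proof.
move=> bD; rewrite {1}(coroot_expansion bD) dot_sumr.
by apply: eq_bigr => i _; rewrite dotZr.
Qed.

Lemma coroot_coef_ge0 b i : b \in pos_roots D -> 0 <= coroot_coef D b i.
Proof.
case/pos_rootsP => bD b0; rewrite coroot_coefE mulr_ge0 // divr_ge0 // ltW //;
  by rewrite dot_gt0 ?simple_neq0 ?(root_neq0 bD).
Qed.

Lemma coroot_coef_simple i j : coroot_coef D (alpha j) i = (j == i)%:R.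
Proof.
rewrite coroot_coefE coord_simple; case: eqP => [->|]; rewrite ?mul0r // mul1r.
by rewrite divff // gt_eqF // dot_gt0 // simple_neq0.
Qed.

Lemma simple_reflection_isometry i : isometry dot (s_ i).
Proof. split; [exact: reflection_linear | exact: reflection_isometry]. Qed.

Lemma simple_reflectionK i : involutive (s_ i).
Proof. exact: reflection_involutive. Qed.

(** By induction along simple reflections: b^v and (s_j b)^v differ by an integral multiple of
    a_j^v, the integer being given by crystallography. *)
Lemma coroot_coef_int b i : b \in pos_roots D -> coroot_coef D b i \is a Num.int.
Proof.
move=> bD; elim/pos_root_ind: b / bD i => [j|b j bD sbD IH] i.
  by rewrite coroot_coef_simple; case: eqP.
suff -> : coroot_coef D b i = coroot_coef D (s_ j b) i -
    dot (s_ j b)^v (alpha j) * coroot_coef D (alpha j) i.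
  rewrite rpredB ?IH // rpredM ?coroot_coef_simple ?rpred_nat //.
  exact: roots_crystallographic (pos_root sbD) (simple_root D j).
have bvE : b^v = (s_ j b)^v - dot (s_ j b)^v (alpha j) *: (alpha j)^v.
  rewrite -{1}[b](simple_reflectionK j) -(isometry_coroot (simple_reflection_isometry j)).
  rewrite /simple_reflection reflectionE; congr (_ - _).
  by rewrite dot_coroot mulrC /coroot scalerA.
by rewrite {1}/coroot_coef bvE linearB; congr (_ - _); exact: linearZ.
Qed.

Lemma coroot_height_int b : b \in pos_roots D -> coroot_height D b \is a Num.int.
Proof. by move=> bD; apply: rpred_sum => i _; exact: coroot_coef_int. Qed.

(** The sum is strictly positive because the coefficients cannot all vanish: <b, b^v> = 2. It turns
    strict bounds on simple coroots into strict bounds on all positive coroots. *)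
Lemma coroot_coef_sum_gt0 b (f : 'I_(@rank R V) -> R) : b \in pos_roots D ->
  (forall i, 0 < f i) -> 0 < \sum_i coroot_coef D b i * f i.
Proof.
move=> bD f0; have c0 i := coroot_coef_ge0 i bD.
have cf0 i : 0 <= coroot_coef D b i * f i by rewrite mulr_ge0 // ltW.
rewrite lt0r sumr_ge0 // andbT; apply/negP; rewrite psumr_eq0 // => /allP cz.
have := dot_corootxx dot (root_neq0 (pos_root bD)).
rewrite (dot_coroot_expansion _ (pos_root bD)) big1 => [/eqP|i _].
  by rewrite eq_sym pnatr_eq0.
have := cz i (mem_index_enum i); rewrite mulf_eq0 (gt_eqF (f0 i)) orbF => /eqP ->.
by rewrite mul0r.
Qed.

Lemma coroot_height_gt0 b : b \in pos_roots D -> 0 < coroot_height D b.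
Proof.
move=> bD; have := coroot_coef_sum_gt0 bD (fun=> ltr01).
by under eq_bigr do rewrite mulr1.
Qed.

(** * The Weyl group and words in simple reflections *)

Lemma weyl_simple i : weyl_group D (s_ i).
Proof. by apply: generated_by1; exists i. Qed.

Lemma weyl_isometry g : weyl_group D g -> isometry dot g.
Proof.
elim=> [|_ h [i _ <-] _ [hl hi]]; first by split.
have [sl si] := simple_reflection_isometry i.
by split=> [c x y|x y] /=; [rewrite hl sl | rewrite si hi].
Qed.

Lemma weyl_roots g b : weyl_group D g -> b \in roots D -> g b \in roots D.
Proof. by move=> Wg bD; elim: Wg => // _ h [i _ <-] _; exact: simple_reflection_root. Qed.

(** Inverses are not built into [generated_by]; they come from reversing a product of
    involutions. *)
Lemma weyl_inverse g : weyl_group D g ->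
  exists2 h, weyl_group D h & cancel g h /\ cancel h g.
Proof.
elim=> [|_ h [i _ <-] _ [k Wk [hk kh]]]; first by exists idfun => //; exact: generated_id.
exists (k \o s_ i); first exact/generated_by_comp/weyl_simple.
by split=> x /=; rewrite ?simple_reflectionK ?kh ?simple_reflectionK ?hk.
Qed.

(** The reflection in [c] is the conjugate by [s_ i] of the reflection in [s_ i c], so induction on
    positive roots applies. *)
Lemma weyl_reflection b : b \in roots D -> weyl_group D (reflection dot b).
Proof.
have pos c : c \in pos_roots D -> weyl_group D (reflection dot c).
  elim/pos_root_ind => [i|{}c i cD sD IH]; first exact: weyl_simple.
  have -> : reflection dot c = s_ i \o (reflection dot (s_ i c) \o s_ i).
    apply/funext => x /=.
    by rewrite (isometry_reflection (simple_reflection_isometry i)) !simple_reflectionK.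
  apply: generated_by_comp (weyl_simple i) _.
  exact: generated_by_comp IH (weyl_simple i).
move=> bD; have [/pos//|/(opp_pos_roots bD)/pos] := boolP (b \in pos_roots D).
by rewrite reflectionN.
Qed.

Definition weyl_word (s : seq 'I_(@rank R V)) : V -> V :=
  foldr (fun i f => s_ i \o f) idfun s.

Lemma weyl_word_cat s t : weyl_word (s ++ t) = weyl_word s \o weyl_word t.
Proof. by elim: s => //= i s ->. Qed.

Lemma weyl_wordP g : weyl_group D g -> exists s, g = weyl_word s.
Proof.
by elim=> [|_ h [i _ <-] _ [s ->]]; [exists [::] | exists (i :: s)].
Qed.

Lemma weyl_word_weyl s : weyl_group D (weyl_word s).
Proof.
elim: s => [|i s IHs]; first exact: generated_id.
exact: generated_by_comp (weyl_simple i) IHs.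
Qed.

(* The deletion property. *)
Lemma weyl_word_delete s i : weyl_word s (alpha i) \notin pos_roots D ->
  exists2 t, (size t < size s)%N & weyl_word (rcons s i) = weyl_word t.
Proof.
elim: s => [|j s IHs] /=; first by rewrite simple_pos_roots.
have [sD|/IHs[t ts ->] _] := boolP (weyl_word s (alpha i) \in pos_roots D); last first.
  by exists (j :: t).
(* [s_ j] makes only one positive root negative, namely [alpha j]. If [weyl_word s] sends [alpha i]
   to it, then conjugation by [weyl_word s] turns [s_ i] into [s_ j], and the letters [j] and [i]
   cancel. *)
have [sj _|/eqP sj] := eqVneq (weyl_word s (alpha i)) (alpha j).
  exists s => //; rewrite -cats1 weyl_word_cat; apply/funext => x /=.
  rewrite (isometry_reflection (weyl_isometry (weyl_word_weyl s))) sj.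
  exact: simple_reflectionK.
by rewrite simple_reflection_pos.
Qed.

(** Induction on the length of a word for [g]. If the word ends in [i], the rest of it sends
    [alpha i] to the negative root -g(a_i), and the deletion property yields a shorter word. *)
Lemma weyl_pos_roots_id g : weyl_group D g ->
  (forall b, b \in pos_roots D -> g b \in pos_roots D) -> g = idfun.
Proof.
move=> /weyl_wordP[s ->]; have [n] := ubnP (size s).
elim: n s => // n IHn s; case/lastP: s => // s i; rewrite size_rcons ltnS => sn gpos.
have /weyl_word_delete[t ts rE] : weyl_word s (alpha i) \notin pos_roots D.
  have := gpos _ (simple_pos_roots i); rewrite -cats1 weyl_word_cat /=.
  rewrite /simple_reflection reflection_self (isometryN (weyl_isometry (weyl_word_weyl s))).
  by move/pos_rootsN; rewrite opprK.
rewrite rE; apply: IHn; first exact: leq_trans ts (ltnW sn).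
by rewrite -rE.
Qed.

(** * The root lattice *)

Lemma root_lattice0 : root_lattice D 0.
Proof. by exists 0; rewrite big1 // => i _; rewrite ffunE mulr0z. Qed.

Lemma root_latticeD x y : root_lattice D x -> root_lattice D y -> root_lattice D (x + y).
Proof.
move=> [a ->] [b ->]; exists (a + b); rewrite -big_split /=.
by apply: eq_bigr => i _; rewrite ffunE mulrzDr.
Qed.

Lemma root_latticeN x : root_lattice D x -> root_lattice D (- x).
Proof.
move=> [a ->]; exists (- a); rewrite -sumrN.
by apply: eq_bigr => i _; rewrite ffunE mulrNz.
Qed.

Lemma root_latticeB x y : root_lattice D x -> root_lattice D y -> root_lattice D (x - y).
Proof. by move=> xL yL; apply: root_latticeD => //; exact: root_latticeN. Qed.

Lemma root_lattice_root b : b \in roots D -> root_lattice D b.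
Proof.
move=> bD; have bi : (index b (enum_fset (roots D)) < size (enum_fset (roots D)))%N.
  by rewrite index_mem.
exists [ffun i => (i == Ordinal bi)%:Z]; rewrite (bigD1 (Ordinal bi)) //= ffunE eqxx.
rewrite mulr1z nth_index // big1 ?addr0 // => i /negPf ib.
by rewrite ffunE ib mulr0z.
Qed.

Lemma root_lattice_mulz x (k : int) : root_lattice D x -> root_lattice D (x *~ k).
Proof.
move=> [a ->]; exists (a *~ k); rewrite mulrz_suml; apply: eq_bigr => i _.
by rewrite ffunMzE -mulrzA mulrzz.
Qed.

(** Negative coefficients are absorbed by replacing a root by its opposite. The list form allows
    induction on the number of roots. *)
Lemma root_lattice_sum x : root_lattice D x ->
  exists2 s : seq V, {subset s <= roots D} & x = \sum_(b <- s) b.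
Proof.
pose Q x := exists2 s : seq V, {subset s <= roots D} & x = \sum_(b <- s) b.
have Q0 : Q 0 by exists [::] => //; rewrite big_nil.
have QD y z : Q y -> Q z -> Q (y + z).
  move=> [s sD ->] [t tD ->]; exists (s ++ t); last by rewrite big_cat.
  by move=> b; rewrite mem_cat => /orP[/sD|/tD].
have QMn y n : Q y -> Q (y *+ n).
  by move=> Qy; elim: n => [|n IHn]; [rewrite mulr0n | rewrite mulrS; exact: QD].
have Q1 b : b \in roots D -> Q b.
  by exists [:: b]; rewrite ?big_seq1 // => c; rewrite inE => /eqP ->.
move=> [a ->]; apply: (big_ind Q) => // i _.
have bD : (in_tuple (enum_fset (roots D)))`_i \in roots D by exact: mem_nth.
by case: (a i) => n; [|rewrite NegzE mulrNz -mulNrz]; apply/QMn/Q1 => //; exact: rootN.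
Qed.

Lemma root_lattice_coroot_int x b : root_lattice D x -> b \in roots D ->
  dot x b^v \is a Num.int.
Proof.
move=> /root_lattice_sum[s sD ->] bD; rewrite dot_suml big_seq; apply: rpred_sum => c /sD cD.
rewrite dotC; exact: roots_crystallographic bD cD.
Qed.

Lemma weyl_root_lattice g x : weyl_group D g -> root_lattice D x -> root_lattice D (g x).
Proof.
move=> Wg /root_lattice_sum[s sD ->]; have giso := weyl_isometry Wg.
elim: s sD => [|b s IHs] sD; first by rewrite big_nil (isometry0 giso); exact: root_lattice0.
rewrite big_cons (isometryD giso); apply: root_latticeD.
  by apply/root_lattice_root/weyl_roots/sD; rewrite ?mem_head.
by apply: IHs => c cs; apply: sD; rewrite inE cs orbT.
Qed.

(* Reflecting in a root [b] of the decomposition with [dot x b > 0] preserves the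
   hypotheses and removes [b], because minusculity forces [dot x b^v = 1]. *)
Lemma minuscule_root_lattice x : root_lattice D x ->
  (forall b, b \in roots D -> dot x b^v <= 1) -> x = 0.
Proof.
move=> /root_lattice_sum[s]; have [n] := ubnP (size s).
elim: n s x => // n IHn s x sn sD xE xmin.
apply: contrapT => /eqP /(dot_gt0 dot) x0.
have [b bs xb] : exists2 b, b \in s & 0 < dot x b.
  apply: contrapT => nb; move: x0; rewrite {2}xE dot_sumr ltNge => /negP[].
  rewrite big_seq; apply: sumr_le0 => b bs; rewrite leNgt; apply/negP => xb.
  by apply: nb; exists b.
have bD := sD b bs; have b0 := dot_gt0 dot (root_neq0 bD).
have xb1 : dot x b^v = 1.
  have /intrP[k kE] : dot x b^v \is a Num.int.
    by apply: root_lattice_coroot_int => //; rewrite xE big_seq;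
      apply: (big_ind _ root_lattice0 root_latticeD) => c /sD /root_lattice_root.
  have : 0 < dot x b^v by rewrite dot_coroot mulr_gt0 // divr_gt0.
  have := xmin b bD; rewrite kE ltr0z -[1]/(1%:~R) ler_int => k1 k0.
  by congr _%:~R; lia.
have sxE : reflection dot b x = x - b by rewrite reflectionE xb1 scale1r.
have xb0 : x - b = 0.
  apply: (IHn (rem b s)); first by rewrite size_rem //; case: (s) bs sn.
  - by move=> c /mem_rem/sD.
  - by rewrite xE (perm_big _ (perm_to_rem bs)) big_cons addrC addKr.
  - move=> c cD; rewrite -sxE; have := xmin _ (roots_reflection bD cD).
    rewrite -(isometry_coroot (weyl_isometry (weyl_reflection bD))).
    by rewrite -{1}[x](reflection_involutive dot b) reflection_isometry.
(* Now [x] = [b], whose pairing with its own coroot is 2, against the bound 1. *)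
have := xmin b bD; rewrite -[x](subrK b) xb0 add0r dot_corootxx ?root_neq0 //.
by rewrite (ler_nat R 2 1).
Qed.

(** * The affine Weyl group as translations times the Weyl group *)

Lemma affine_weyl_decomposition w : affine_weyl_group D w ->
  exists x g, [/\ root_lattice D x, weyl_group D g & w = translation x \o g].
Proof.
elim=> [|_ _ [a aD [k ->]] _ [x [g [xL Wg ->]]]].
  exists 0, idfun; split; [exact: root_lattice0 | exact: generated_id |].
  by apply/funext => x; rewrite /translation /= add0r.
have Wa := weyl_reflection aD; rewrite affine_reflectionE.
exists (k%:~R *: a + reflection dot a x), (reflection dot a \o g); split.
- apply: root_latticeD; last exact: weyl_root_lattice.
  by rewrite scaler_int; apply/root_lattice_mulz/root_lattice_root.
- exact: generated_by_comp.
- by apply/funext => y; rewrite /= /translation (isometryD (weyl_isometry Wa)) addrA.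
Qed.

(** The translation by a root [b] is s_{b,1} s_{b,0}, and a lattice vector is a sum of roots. *)
Lemma affine_weyl_translation x : root_lattice D x -> affine_weyl_group D (translation x).
Proof.
move=> /root_lattice_sum[s]; elim: s x => [|b s IHs] x sD ->.
  rewrite big_nil; suff -> : translation (0 : V) = idfun by exact: generated_id.
  by apply/funext => y; rewrite /translation add0r.
have bD : b \in roots D by rewrite sD // mem_head.
have -> : translation (\sum_(c <- b :: s) c) = affine_reflection dot b 1 \o
    (affine_reflection dot b 0 \o translation (\sum_(c <- s) c)).
  apply/funext => y; rewrite /= !affine_reflectionE /= /translation scale0r add0r.
  by rewrite reflection_involutive scale1r big_cons addrA.
do 2![apply: generated_comp; first by exists b => //; eexists].
by apply: IHs => // c cs; apply: sD; rewrite inE cs orbT.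
Qed.

Lemma weyl_affine g : weyl_group D g -> affine_weyl_group D g.
Proof.
apply: generated_by_subset => _ [i _ <-]; apply: generated_by1.
by exists (alpha i); [exact: simple_root | exists 0].
Qed.

(** * Alcoves and Shi vectors *)

Lemma fundamental_alcoveP x : fundamental_alcove D x <->
  forall b, b \in pos_roots D -> 0 < dot x b^v < 1.
Proof.
split=> [xA b bD|xA b _]; last by rewrite /strip /= add0r; exact/xA/valP.
by have := xA [` bD]%fset I; rewrite /strip /= add0r.
Qed.

Lemma fundamental_alcove_root x b : fundamental_alcove D x -> b \in roots D ->
  -1 < dot x b^v < 1.
Proof.
move=> /fundamental_alcoveP xA bD.
have [/xA|/(opp_pos_roots bD)/xA] := boolP (b \in pos_roots D); first by lra.
by rewrite corootN dotNr; lra.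
Qed.

(** Serves both to find a point of the fundamental alcove and to bound the admissible vectors. *)
Lemma coroot_height_bound : exists N : nat,
  forall b, b \in pos_roots D -> coroot_height D b < N%:R.
Proof.
pose S := \sum_(b : pos_roots D) coroot_height D (val b).
have h0 (b : pos_roots D) : 0 <= coroot_height D (val b).
  by exact/ltW/coroot_height_gt0/valP.
have S0 : 0 <= S by exact: sumr_ge0.
exists (Num.bound S) => b bD; apply: le_lt_trans (archi_boundP S0).
by rewrite /S (bigD1 [` bD]%fset) //= lerDl; apply: sumr_ge0 => i _; exact: h0.
Qed.

Lemma fundamental_alcove_neq0 : exists x, fundamental_alcove D x.
Proof.
(* This [x] pairs with b^v to h(b^v) / (N + 1), which lies between 0 and 1. *)
have [N hN] := coroot_height_bound; have [x xE] := dual_vector (fun=> N.+1%:R^-1).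
exists x; apply/fundamental_alcoveP => b bD.
rewrite (dot_coroot_expansion _ (pos_root bD)) (eq_bigr _ (fun i _ => congr1 _ (xE i))).
rewrite -mulr_suml divr_gt0 ?coroot_height_gt0 //= ltr_pdivrMr // mul1r.
by rewrite (lt_le_trans (hN _ bD)) // ler_nat.
Qed.

Lemma strip_inj b (k l : int) x : strip dot b k x -> strip dot b l x -> k = l.
Proof.
rewrite /strip /= -[1]/(1%:~R) -!intrD => /andP[k1 k2] /andP[l1 l2].
have := lt_trans k1 l2; have := lt_trans l1 k2; rewrite !ltr_int; lia.
Qed.

Lemma alcove_strips w : affine_weyl_group D w ->
  exists k : {ffun pos_roots D -> int},
    alcove D w = \bigcap_(b in [set: pos_roots D]) strip dot (val b) (k b).
Proof.
move=> /affine_weyl_decomposition[x [g [xL Wg ->]]].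
have [h Wh [hg gh]] := weyl_inverse Wg.
have giso := weyl_isometry Wg; have hiso := weyl_isometry Wh.
have dot_h y b : dot (h y) b = dot y (g b) by rewrite -(proj2 giso) gh.
have dot_g y b : dot (g y) b = dot y (h b) by rewrite -(proj2 hiso) hg.
have /all_tag/= [n nE] : forall b : pos_roots D, {n : int | dot x (val b)^v = n%:~R}.
  move=> b; apply: cid; apply/intrP/root_lattice_coroot_int => //.
  exact/pos_root/valP.
(* For [y] in the fundamental alcove, <x + g y, b^v> is the integer <x, b^v> plus the pairing of [y]
   with the coroot of [h b], which lies in (0, 1) or in (-1, 0) according to the sign of this
   root. *)
exists [ffun b => if h (val b) \in pos_roots D then n b else n b - 1].
apply/seteqP; split=> [_ [y /fundamental_alcoveP yA <-] b _|y yS].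
  rewrite ffunE /strip /= /translation dotDl nE dot_g (isometry_coroot hiso).
  have hbD : h (val b) \in roots D by exact/weyl_roots/pos_root/valP.
  have [/yA|/(opp_pos_roots hbD)/yA] := boolP (h (val b) \in pos_roots D); first by lra.
  by rewrite corootN dotNr rmorphB /=; lra.
exists (h (y - x)); last by rewrite /= gh /translation addrC subrK.
apply/fundamental_alcoveP => c cD.
rewrite dot_h (isometry_coroot giso) dotBl.
have gcD : g c \in roots D by exact/weyl_roots/pos_root.
have [gD|/(opp_pos_roots gcD) gD] := boolP (g c \in pos_roots D).
  have := yS [` gD]%fset I; have := nE [` gD]%fset.
  by rewrite /strip /= ffunE /= hg cD; lra.
have := yS [` gD]%fset I; have := nE [` gD]%fset.
rewrite /strip /= ffunE /= (isometryN hiso) hg (negPf (pos_rootsN cD)) corootN !dotNr.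
by rewrite rmorphB /=; lra.
Qed.

Lemma shi_vectorP w : affine_weyl_group D w -> alcove D w =
  \bigcap_(b in [set: pos_roots D]) strip dot (val b) (shi_vector D w b).
Proof. by move=> /alcove_strips kE; have := xgetPex [ffun=> 0] kE. Qed.

Lemma shi_vector_strip w x (b : pos_roots D) : affine_weyl_group D w -> alcove D w x ->
  strip dot (val b) (shi_vector D w b) x.
Proof. by move=> Ww; rewrite (shi_vectorP Ww) => /(_ b I). Qed.

Lemma alcove_neq0 w : exists x, alcove D w x.
Proof. by have [x xA] := fundamental_alcove_neq0; exists (w x), x. Qed.

Lemma shi_vector_translation x w (b : pos_roots D) :
  root_lattice D x -> affine_weyl_group D w ->
  (shi_vector D (translation x \o w) b)%:~R =
    dot x (val b)^v + (shi_vector D w b)%:~R.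
Proof.
move=> xL Ww; have [_ [a aA _]] := alcove_neq0 w.
have Wxw : affine_weyl_group D (translation x \o w).
  by apply: generated_by_comp => //; exact: affine_weyl_translation.
have /intrP[n nE] : dot x (val b)^v \is a Num.int.
  exact/root_lattice_coroot_int/pos_root/valP.
have /(shi_vector_strip b Ww) wS : alcove D w (w a) by exists a.
have /(shi_vector_strip b Wxw) xwS : alcove D (translation x \o w) (x + w a) by exists a.
rewrite nE -intrD; congr _%:~R; apply: (strip_inj xwS).
by move: wS; rewrite /strip /= dotDl nE intrD; lra.
Qed.

Lemma alcove_inj w w' : affine_weyl_group D w -> affine_weyl_group D w' ->
  alcove D w = alcove D w' -> w = w'.
Proof.
move=> /affine_weyl_decomposition[x [g [xL Wg ->]]].
move=> /affine_weyl_decomposition[x' [g' [xL' Wg' ->]]] AE.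
have [h Wh [hg gh]] := weyl_inverse Wg; have [h' Wh' [hg' gh']] := weyl_inverse Wg'.
have giso := weyl_isometry Wg; have hiso := weyl_isometry Wh.
have giso' := weyl_isometry Wg'; have hiso' := weyl_isometry Wh'.
have dot_hg y b : dot (h (g' y)) b = dot y (h' (g b)).
  by rewrite -(proj2 giso) gh -(proj2 hiso') hg'.
(* This is the image of [a] under (tau_x g)^-1 tau_x' g', which stabilizes the fundamental alcove by
   [AE]. *)
have yA a : fundamental_alcove D a -> fundamental_alcove D (h (x' - x) + h (g' a)).
  move=> aA; have : alcove D (translation x \o g) (x' + g' a) by rewrite AE; exists a.
  case=> a' aA' /=; rewrite /translation => a'E; suff <- : a' = h (x' - x) + h (g' a) by [].
  by rewrite -(isometryD hiso) addrAC -a'E addrAC subrr add0r hg.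
have y0 : h (x' - x) = 0.
  apply: minuscule_root_lattice => [|b bD].
    by apply: weyl_root_lattice => //; exact: root_latticeB.
  have [a aA] := fundamental_alcove_neq0.
  have := fundamental_alcove_root (yA a aA) bD.
  have := fundamental_alcove_root aA (weyl_roots Wh' (weyl_roots Wg bD)).
  rewrite dotDl dot_hg (isometry_coroot giso) (isometry_coroot hiso').
  have /intrP[k ->] : dot (h (x' - x)) b^v \is a Num.int.
    apply: root_lattice_coroot_int => //; apply: weyl_root_lattice => //.
    exact: root_latticeB.
  (* The integer [k] is a difference of two numbers in (-1, 1), hence less than 2 and so at most
     1. *)
  move=> r1 r2; have : k%:~R < 2%:~R :> R by rewrite /=; lra.
  by rewrite ltr_int => k2; rewrite -[X in _ <= X]/(1%:~R) ler_int; lia.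
have hg'id : h' \o g = idfun.
  apply: weyl_pos_roots_id => [|b bD]; first exact: generated_by_comp.
  have kbD : h' (g b) \in roots D by exact/weyl_roots/weyl_roots/pos_root.
  (* By [y0], [h \o g'] preserves the fundamental alcove. If [h' (g b)] were negative, h(g'(a))
     would pair negatively with b^v. *)
  apply/negPn/negP => /(opp_pos_roots kbD) nbD; have [a aA] := fundamental_alcove_neq0.
  have /fundamental_alcoveP/(_ _ bD) := yA a aA; have /fundamental_alcoveP/(_ _ nbD) := aA.
  rewrite y0 add0r dot_hg (isometry_coroot giso) (isometry_coroot hiso') corootN dotNr.
  by lra.
have xx' : x = x'.
  by apply/esym/eqP; rewrite -subr_eq0 -[_ - _]gh y0 (isometry0 giso).
rewrite xx'; congr (_ \o _); apply/funext => z.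
by rewrite -[LHS]gh' -[h' (g z)]/((h' \o g) z) hg'id.
Qed.

(** * Sections and their cohomology classes *)

(* This is [tau_z g tau_{-z}], for [z] in [V] rather than in the root lattice. *)
Definition conj_section z g : V -> V := translation (z - g z) \o g.

Lemma sub_simple_reflection z i : z - s_ i z = dot z (alpha i)^v *: alpha i.
Proof. by rewrite /simple_reflection reflectionE opprB addrCA subrr addr0. Qed.

Lemma conj_section_simple z i :
  conj_section z (s_ i) = translation (dot z (alpha i)^v *: alpha i) \o s_ i.
Proof. by rewrite /conj_section sub_simple_reflection. Qed.

(** Induction on [g] through z - s_i g z = (z - s_i z) + s_i (z - g z), whose first term is an
    integral multiple of a_i. Thus conjugation by [z] stays in the affine Weyl group even for [z]
    outside the root lattice. *)
Lemma sub_weyl_root_lattice z g : (forall i, dot z (alpha i)^v \is a Num.int) ->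
  weyl_group D g -> root_lattice D (z - g z).
Proof.
move=> zint; elim=> [|_ h [i _ <-] Wh IH] /=; first by rewrite subrr; exact: root_lattice0.
rewrite -[z - _](subrKA (s_ i z)) -(isometryB (simple_reflection_isometry i)).
apply: root_latticeD; last exact: weyl_root_lattice (weyl_simple i) IH.
rewrite sub_simple_reflection.
have /intrP[k ->] := zint i; rewrite scaler_int.
exact/root_lattice_mulz/root_lattice_root/simple_root.
Qed.

Lemma conj_section_is_section z : (forall i, dot z (alpha i)^v \is a Num.int) ->
  is_section D (conj_section z).
Proof.
move=> zint; split=> [g Wg|g h Wg Wh|g Wg].
- apply: generated_by_comp; last exact: weyl_affine.
  exact/affine_weyl_translation/sub_weyl_root_lattice.
- apply/funext => y; rewrite /conj_section /= /translation.
  by rewrite (isometryD (weyl_isometry Wg)) (isometryB (weyl_isometry Wg)) addrA subrKA.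
- apply/funext => y; rewrite /conj_section /linear_part /= /translation.
  by rewrite (isometry0 (weyl_isometry Wg)) addr0 addrC addKr.
Qed.

(** The value at the identity is a translation, as its linear part is trivial, and it equals its own
    square. *)
Lemma is_section_id s : is_section D s -> s idfun = idfun.
Proof.
case=> _ sM slin; have W1 : weyl_group D idfun by exact: generated_id.
have sE y : s idfun y = y + s idfun 0.
  have := congr1 (fun f => f y) (slin _ W1); rewrite /linear_part /= => e.
  by rewrite -[in RHS]e subrK.
have e : s idfun 0 = s idfun (s idfun 0).
  by rewrite -[in RHS]/((s idfun \o s idfun) 0) -sM.
have s0 : s idfun 0 = 0 by apply: (addrI (s idfun 0)); rewrite addr0 [RHS]e [RHS]sE.
by apply/funext => y; rewrite sE s0 addr0.
Qed.

Lemma is_section_ext s t : is_section D s -> is_section D t ->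
  (forall i, s (s_ i) = t (s_ i)) -> forall g, weyl_group D g -> s g = t g.
Proof.
move=> Ss St st g; elim=> [|_ h [i _ <-] Wh IH]; first by rewrite !is_section_id.
case: Ss => _ sM _; case: St => _ tM _.
by rewrite (sM _ _ (weyl_simple i) Wh) (tM _ _ (weyl_simple i) Wh) st IH.
Qed.

Lemma shi_section_cocycle w z :
  (forall i, dot z (alpha i)^v = (shi_vector D w (simple_pos D i))%:~R) ->
  forall g, weyl_group D g -> section_cocycle (shi_section D w) g = z - g z.
Proof.
move=> zE g Wg; have zint i : dot z (alpha i)^v \is a Num.int by rewrite zE intr_int.
have Sz := conj_section_is_section zint.
rewrite /section_cocycle /shi_section.
(* [conj_section z] meets the specification, which excludes the default value of [xget]; a section
   meeting it is determined by its values on the simple reflections. *)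
case: xgetP => [s _ [sS sE]|/(_ (conj_section z))[]]; last first.
  by split=> // i; rewrite conj_section_simple zE.
rewrite (is_section_ext sS Sz) //; last first.
  by move=> i; rewrite sE conj_section_simple zE.
by rewrite /conj_section /= /translation (isometry0 (weyl_isometry Wg)) addr0.
Qed.

(** The two cocycles differ by the coboundary of z' - z, a vector of [V]. A lattice vector with the
    same coboundary must equal z' - z, since the values at the simple reflections give all pairings
    with simple coroots. *)
Lemma cohomology_class_eq (f f' : (V -> V) -> V) z z' :
  (forall i, dot z (alpha i)^v \is a Num.int) ->
  (forall i, dot z' (alpha i)^v \is a Num.int) ->
  (forall g, weyl_group D g -> f g = z - g z) ->
  (forall g, weyl_group D g -> f' g = z' - g z') ->
  cohomology_class D f = cohomology_class D f' <-> root_lattice D (z' - z).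
Proof.
move=> zint z'int fE f'E; split=> [ff'|zL].
  have : cohomology_class D f' f'.
    split; last first.
      exists 0 => [|g Wg]; first exact: root_lattice0.
      by rewrite (isometry0 (weyl_isometry Wg)) !subrr.
    split=> [g Wg|g h Wg Wh]; first by rewrite f'E //; exact: sub_weyl_root_lattice.
    rewrite !f'E //; last exact: generated_by_comp.
    by rewrite (isometryB (weyl_isometry Wg)) subrKA.
  rewrite -ff' => -[_ [u uL uE]]; suff -> : z' - z = u by [].
  apply: dot_simple_coroot_ext => i; have := uE _ (weyl_simple i).
  rewrite f'E ?fE; [|exact: weyl_simple|exact: weyl_simple].
  rewrite !sub_simple_reflection.
  rewrite -scalerBl dotBl => /(congr1 (coord (simple D) i)).
  by rewrite !linearZ /= coord_simple eqxx !mulr1.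
have shift t : root_lattice D t -> forall (k k' : (V -> V) -> V) ,
    (forall g, weyl_group D g -> k g - k' g = t - g t) ->
    cohomology_class D k `<=` cohomology_class D k'.
  move=> tL k k' kk' e [ec [v vL vE]]; split=> //.
  exists (v + t); first exact: root_latticeD.
  move=> g Wg; rewrite (isometryD (weyl_isometry Wg)) -(subrKA (k g)) vE // kk' //.
  by rewrite opprD addrACA.
apply/seteqP; split.
  apply: (shift (z - z')); first by rewrite -opprB; exact: root_latticeN.
  move=> g Wg; rewrite fE // f'E // (isometryB (weyl_isometry Wg)).
  by rewrite !opprB addrACA [in RHS]addrACA; congr (_ + _); rewrite addrC.
apply: (shift (z' - z)) => // g Wg; rewrite fE // f'E // (isometryB (weyl_isometry Wg)).
by rewrite !opprB addrACA [in RHS]addrACA; congr (_ + _); rewrite addrC.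
Qed.

(** * Shi points lie on the Shi variety *)

(* With roots of norm at least 1, this turns strict inequalities between integral
   combinations of the three norms into the [+ 1] and [- 1] of [admitted]. *)
Lemma root_sum_norms a b : a \in roots D -> b \in roots D -> a + b \in roots D ->
  exists c, exists na nb nc : int, [/\ c \in roots D,
    dot a a = na%:~R * dot c c, dot b b = nb%:~R * dot c c &
    dot (a + b) (a + b) = nc%:~R * dot c c].
Proof.
move=> aD bD cD.
have a0 := dot_gt0 dot (root_neq0 aD); have b0 := dot_gt0 dot (root_neq0 bD).
have /intrP[p pE] := roots_crystallographic aD bD.
have /intrP[q qE] := roots_crystallographic bD aD.
have {}pE : 2 * dot a b = p%:~R * dot a a.
  by rewrite -pE (dotC dot a^v) dot_coroot (dotC dot b); field; rewrite gt_eqF.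
have {}qE : 2 * dot a b = q%:~R * dot b b.
  by rewrite -qE (dotC dot b^v) dot_coroot; field; rewrite gt_eqF.
have ncE : dot (a + b) (a + b) = dot a a + dot b b + 2 * dot a b.
  by rewrite dotDl !dotDr (dotC dot b a); ring.
have CS : dot a b ^+ 2 < dot a a * dot b b.
  (* Strictness in Cauchy-Schwarz: if proportional, [a] and [b] would be equal or opposite by
     reducedness, making a + b equal to 2b or 0, neither of which is a root. *)
  have neq0 : dot b b *: a - dot a b *: b != 0.
    apply/negP; rewrite subr_eq0 => /eqP e.
    have aE : a = (dot a b / dot b b) *: b.
      by rewrite mulrC -scalerA -e scalerA mulVf ?scale1r // gt_eqF.
    have := aD; rewrite aE => /(roots_reduced bD)[tE|tE].
      move: cD; rewrite aE tE scale1r -mulr2n -scaler_nat => /(roots_reduced bD).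
      by case; lra.
    by move/root_neq0: cD; rewrite aE tE scaleN1r addNr eqxx.
  have := dot_gt0 dot neq0; rewrite dotBl !dotBr !dotZl !dotZr (dotC dot b a).
  have -> : dot b b * (dot b b * dot a a) - dot b b * (dot a b * dot a b) -
    (dot a b * (dot b b * dot a b) - dot a b * (dot a b * dot b b)) =
    dot b b * (dot a a * dot b b - dot a b ^+ 2) by ring.
  by rewrite pmulr_rgt0 // subr_gt0.
have pq4 : p * q < 4.
  rewrite -(ltr_int R) intrM /= -(ltr_pM2r (mulr_gt0 a0 b0)).
  have -> : p%:~R * q%:~R * (dot a a * dot b b) = 4 * dot a b ^+ 2.
    by rewrite mulrACA -pE -qE; ring.
  by rewrite -[4%:~R]/(4 : R) ltr_pM2l.
have pq_sign : (0 < p) = (0 < q) /\ (p < 0) = (q < 0).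
  rewrite -!(ltr_int R) /=; split.
    by rewrite -(pmulr_lgt0 _ a0) -pE qE pmulr_lgt0.
  by rewrite -(pmulr_llt0 _ a0) -pE qE pmulr_llt0.
(* Here [p] and [q] have the same sign and p q < 4, so they cannot both have absolute value at least
   2. *)
have : [\/ q = 1 \/ q = -1, p = 1 \/ p = -1 | p = 0 /\ q = 0].
  case: pq_sign => s1 s2.
  suff : [|| q == 1, q == -1, p == 1, p == -1 | (p == 0) && (q == 0)].
    case/or4P => [/eqP|/eqP|/eqP|/orP[/eqP|/andP[/eqP + /eqP]]];
      by [constructor 1; left|constructor 1; right|constructor 2; left|
        constructor 2; right|constructor 3].
  nia.
case=> [[]q1|[]p1|[p0 q0]].
- exists a, 1, p, (1 + 2 * p); split=> //; rewrite ?mul1r // -?pE ?qE ?q1 ?mul1r //.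
  by rewrite ncE qE q1 intrD intrM /= mul1r mulrDl mul1r -mulrA -pE qE q1; ring.
- exists a, 1, (- p), 1; split=> //; rewrite ?mul1r // ?ncE ?qE ?q1 ?mulN1r ?addrK //.
  by rewrite intrN mulNr -pE qE q1 mulN1r opprK.
- exists b, q, 1, (1 + 2 * q); split=> //; rewrite ?mul1r // -?qE ?pE ?p1 ?mul1r //.
  by rewrite ncE pE p1 intrD intrM /= mul1r mulrDl mul1r -mulrA -qE pE p1; ring.
- exists b, (- q), 1, 1; split=> //; rewrite ?mul1r // ?ncE ?pE ?p1 ?mulN1r //.
    by rewrite intrN mulNr -qE pE p1 mulN1r opprK.
  by rewrite addrAC subrr add0r.
(* For orthogonal [a] and [b], the integer <a, (a + b)^v> equals 2|a|^2 / (|a|^2 + |b|^2), which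
   lies strictly between 0 and 2; hence the norms are equal. *)
have ab0 : 2 * dot a b = 0 by rewrite pE p0 mul0r.
have /intrP[m mE] := roots_crystallographic cD aD.
have {}mE : 2 * dot a a = m%:~R * (dot a a + dot b b).
  have c0 : 0 < dot a a + dot b b by rewrite addr_gt0.
  rewrite -mE (dotC dot _^v) dot_coroot ncE ab0 addr0 dotDr.
  have -> : dot a b = 0 by lra.
  by field; rewrite gt_eqF.
have m1 : m = 1.
  have : 0 < m%:~R :> R by rewrite -(pmulr_lgt0 _ (addr_gt0 a0 b0)) -mE mulr_gt0.
  have : m%:~R < 2%:~R :> R.
    by rewrite -(ltr_pM2r (addr_gt0 a0 b0)) -mE ltr_pM2l // ltrDl.
  by rewrite ltr_int ltr0z; lia.
move: mE; rewrite m1 mul1r => ba.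
exists a, 1, 1, 2; split=> //; rewrite ?mul1r // ?ncE ?ab0 ?addr0 /=; lra.
Qed.

Lemma coroot_coef_sum a b i : dot (a + b) (a + b) * coroot_coef D (a + b) i =
  dot a a * coroot_coef D a i + dot b b * coroot_coef D b i.
Proof.
rewrite /coroot_coef; set X := map_tuple _ _.
have H c : dot c c * coord X i c^v = coord X i (2 *: c).
  by rewrite -(scale_coroot dot) [RHS]linearZ.
by rewrite !H scalerDr linearD.
Qed.

Lemma shi_point_strip w x i : affine_weyl_group D w -> alcove D w x ->
  shi_point D w (simple_pos D i) < dot x (alpha i)^v < shi_point D w (simple_pos D i) + 1.
Proof. by rewrite ffunE => Ww; exact: (shi_vector_strip (simple_pos D i) Ww). Qed.

(** For [x] in the alcove, <x, b^v> lies in (k_b, k_b + 1) and, by summing over simple coroots, in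
    (P_b, P_b + h(b^v)); so the integer l_b = k_b - P_b satisfies -1 < l_b < h(b^v). The other
    inequalities compare three strips through |c|^2 <x, c^v> = |a|^2 <x, a^v> + |b|^2 <x, b^v> for c
    = a + b. *)
Lemma shi_point_admitted (Dnorm : normalized D) w : affine_weyl_group D w ->
  exists2 l, admitted l & shi_subspace l (shi_point D w).
Proof.
move=> Ww; have [x xA] := alcove_neq0 w; set k := shi_vector D w.
pose P (b : pos_roots D) := shi_linear_form b (shi_point D w).
have /all_tag/= [l lE] : forall b : pos_roots D, {n : int | n%:~R = (k b)%:~R - P b}.
  move=> b; suff /intrP/cid[n nE] : (k b)%:~R - P b \is a Num.int by exists n.
  rewrite rpredB ?intr_int //; apply: rpred_sum => i _; rewrite ffunE.
  by rewrite rpredM ?intr_int //; apply/coroot_coef_int/valP.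
have xk (b : pos_roots D) : (k b)%:~R < dot x (val b)^v < (k b)%:~R + 1.
  exact: shi_vector_strip b Ww xA.
have xP (b : pos_roots D) : P b < dot x (val b)^v < P b + coroot_height D (val b).
  have bD := valP b; rewrite (dot_coroot_expansion _ (pos_root bD)).
  have xi i := shi_point_strip i Ww xA; rewrite /P /shi_linear_form /coroot_height.
  apply/andP; split; rewrite -subr_gt0 -?big_split -sumrB /=.
    under eq_bigr do rewrite -mulrBr.
    by apply: coroot_coef_sum_gt0 => // i; have := xi i; lra.
  under eq_bigr do rewrite -[X in _ * _ + X]mulr1 -mulrDr -mulrBr.
  by apply: coroot_coef_sum_gt0 => // i; have := xi i; lra.
exists [ffun b : pos_roots D => l b]; last by move=> b; rewrite !ffunE lE addrC subrK.
split=> [b|a b c cE /=].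
  rewrite ffunE; have /intrP[h hE] := coroot_height_int (valP b).
  have := xk b; have := xP b; have := lE b; rewrite hE => lbE xPb xkb; split.
    suff : -1%:~R < (l b)%:~R :> R by rewrite -intrN ltr_int; lia.
    by rewrite /=; lra.
  rewrite -[1]/(1%:~R) -intrB ler_int; suff : l b < h by lia.
  by rewrite -(ltr_int R); lra.
have := root_sum_norms (pos_root (valP a)) (pos_root (valP b)).
rewrite -cE => /(_ (pos_root (valP c)))[d [na [nb [nc [dD aE bE cE']]]]].
have Pabc : dot (val c) (val c) * P c =
    dot (val a) (val a) * P a + dot (val b) (val b) * P b.
  rewrite !mulr_sumr -big_split /=; apply: eq_bigr => i _.
  by rewrite cE !mulrA coroot_coef_sum mulrDl.
have xabc : dot (val c) (val c) * dot x (val c)^v =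
    dot (val a) (val a) * dot x (val a)^v + dot (val b) (val b) * dot x (val b)^v.
  by rewrite -!dotZr !scale_coroot cE scalerDr dotDr.
have d1 := Dnorm d dD; have d0 : 0 < dot d d by rewrite (lt_le_trans _ d1).
(* The only use of the normalization: a positive integral multiple of <d, d> is at least 1. *)
have gap (n : int) : 0 < n%:~R * dot d d -> 1 <= n%:~R * dot d d.
  rewrite pmulr_lgt0 // ltr0z => n0; rewrite (le_trans d1) // ler_peMl ?(ltW d0) //.
  by rewrite -[1]/(1%:~R) ler_int; lia.
have xk_scaled (b' : pos_roots D) : let n := dot (val b') (val b') in
    n * (k b')%:~R < n * dot x (val b')^v < n * ((k b')%:~R + 1).
  by rewrite /= !ltr_pM2l ?xk // dot_gt0 // (root_neq0 (pos_root (valP b'))).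
have /andP[xa1 xa2] := xk_scaled a; have /andP[xb1 xb2] := xk_scaled b.
have /andP[xc1 xc2] := xk_scaled c.
(* This difference and the next one are positive by the strips, hence at least 1. Substituting k = P
   + l, the terms in P cancel by [Pabc]. *)
have := gap (nc * (k c + 1) - na * k a - nb * k b).
have -> : (nc * (k c + 1) - na * k a - nb * k b)%:~R * dot d d =
    dot (val c) (val c) * ((k c)%:~R + 1) - dot (val a) (val a) * (k a)%:~R -
    dot (val b) (val b) * (k b)%:~R by rewrite aE bE cE'; ring.
have := gap (na * (k a + 1) + nb * (k b + 1) - nc * k c).
have -> : (na * (k a + 1) + nb * (k b + 1) - nc * k c)%:~R * dot d d =
    dot (val a) (val a) * ((k a)%:~R + 1) + dot (val b) (val b) * ((k b)%:~R + 1) -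
    dot (val c) (val c) * (k c)%:~R by rewrite aE bE cE'; ring.
rewrite !ffunE !lE => gap2 gap1.
have {}gap1 := gap1 ltac:(clear gap2; lra); have {}gap2 := gap2 ltac:(clear gap1; lra).
by move: gap1 gap2 Pabc => /= gap1 gap2 Pabc; apply/andP; split; lra.
Qed.

(** * Irreducible components of the Shi variety *)

Section ShiSubspace.
Implicit Types l : {ffun pos_roots D -> int}.

Lemma shi_subspace_closed l : zariski_closed (shi_subspace l).
Proof.
(* Row [b] holds the coefficients of the linear form x_b - P_b(x). *)
pose c : {ffun pos_roots D -> {ffun pos_roots D -> R}} := [ffun b => [ffun b' =>
  (b' == b)%:R - \sum_i coroot_coef D (val b) i * (b' == simple_pos D i)%:R]].
have delta (x : {ffun pos_roots D -> R}) (b : pos_roots D) :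
    \sum_b' (b' == b)%:R * x b' = x b.
  rewrite (bigD1 b) //= eqxx mul1r big1 ?addr0 // => b' /negPf ->.
  by rewrite mul0r.
have cE (x : {ffun pos_roots D -> R}) (b : pos_roots D) :
    \sum_b' c b b' * x b' = x b - shi_linear_form b x.
  under eq_bigr do rewrite !ffunE mulrBl mulr_suml.
  rewrite big_split /= delta sumrN exchange_big /=; congr (_ - _); apply: eq_bigr => i _.
  by rewrite -[in RHS]delta mulr_sumr; apply: eq_bigr => b' _; rewrite mulrA.
have -> : shi_subspace l = [set x : {ffun pos_roots D -> R} |
    forall b : pos_roots D, \sum_b' c b b' * x b' = (l b)%:~R].
  by apply/seteqP; split=> x xl b; have := xl b; rewrite cE => /= xb; lra.
exact: affine_zariski_closed.
Qed.

Lemma shi_subspace_irreducible l : shi_subspace l !=set0 ->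
  irreducible_set (shi_subspace l).
Proof.
move=> l0; apply: line_irreducible => // x y t xl yl b.
have -> : shi_linear_form b [ffun i => x i + t * (y i - x i)] =
    shi_linear_form b x + t * (shi_linear_form b y - shi_linear_form b x).
  rewrite /shi_linear_form -sumrB mulr_sumr -big_split /=; apply: eq_bigr => i _.
  by rewrite !ffunE; ring.
by rewrite ffunE xl yl; ring.
Qed.

Lemma shi_subspace_inj l l' (x : {ffun pos_roots D -> R}) :
  shi_subspace l x -> shi_subspace l' x -> l = l'.
Proof.
move=> xl xl'; apply/ffunP => b; apply/eqP; rewrite -(eqr_int R); apply/eqP.
by apply: (addrI (shi_linear_form b x)); rewrite -xl -xl'.
Qed.

(** Admissible vectors have entries in 0, ..., N - 1, so the variety is covered by finitely many
    closed subspaces, indexed by all vectors with such entries, and irreducibility selects one. *)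
Lemma irreducible_sub_shi_variety C : irreducible_set C -> C `<=` shi_variety D ->
  exists l, C `<=` shi_subspace l.
Proof.
move=> Cirr CS; have [N hN] := coroot_height_bound.
pose L (f : {ffun pos_roots D -> 'I_N}) : {ffun pos_roots D -> int} :=
  [ffun b : pos_roots D => (f b : nat)%:Z].
have [f Cf] : exists f, C `<=` shi_subspace (L f).
  apply: (irreducible_bigsetU (s := enum {ffun pos_roots D -> 'I_N})) => //.
    by move=> f; exact: shi_subspace_closed.
  move=> x /CS[l [ladm _] xl]; rewrite -bigcup_seq.
  have lN (b : pos_roots D) : (`|l b| < N)%N.
    have [l0 lh] := ladm b; rewrite -(ltr_nat R) natr_absz ger0_norm //.
    by have := hN _ (valP b); lra.
  exists [ffun b : pos_roots D => Ordinal (lN b)]; first by rewrite /= mem_enum.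
  suff -> : L [ffun b : pos_roots D => Ordinal (lN b)] = l by [].
  by apply/ffunP => b; rewrite !ffunE /= gez0_abs //; have [] := ladm b.
by exists (L f).
Qed.

(** A larger irreducible subset lies in a single X[l'], and a point common to X[l] and X[l'] forces
    l = l'. *)
Lemma shi_subspace_component l : admitted l -> shi_subspace l !=set0 ->
  irreducible_component (shi_variety D) (shi_subspace l).
Proof.
move=> ladm l0; split; [by move=> x xl; exists l | exact: shi_subspace_irreducible |].
move=> C Cirr lC CS; have [l' Cl'] := irreducible_sub_shi_variety Cirr CS.
suff ll' : l = l' by apply/seteqP; split=> //; rewrite ll'.
by have [x xl] := l0; apply: (shi_subspace_inj xl); exact/Cl'/lC.
Qed.

End ShiSubspace.

(** * Comparison of two elements of the affine Weyl group *)

Lemma shi_vector_section_class w w' z z' :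
  (forall i, dot z (alpha i)^v = (shi_vector D w (simple_pos D i))%:~R) ->
  (forall i, dot z' (alpha i)^v = (shi_vector D w' (simple_pos D i))%:~R) ->
  cohomology_class D (section_cocycle (shi_section D w)) =
    cohomology_class D (section_cocycle (shi_section D w')) <->
  root_lattice D (z' - z).
Proof.
move=> zE z'E; apply: cohomology_class_eq (shi_section_cocycle zE) (shi_section_cocycle z'E).
  by move=> i; rewrite zE intr_int.
by move=> i; rewrite z'E intr_int.
Qed.

Lemma shi_linear_form_simple_ext x (p q : {ffun pos_roots D -> R}) (b : pos_roots D) :
  (forall i, q (simple_pos D i) = dot x (alpha i)^v + p (simple_pos D i)) ->
  shi_linear_form b q = dot x (val b)^v + shi_linear_form b p.
Proof.
move=> qE; rewrite (dot_coroot_expansion _ (pos_root (valP b))) -big_split /=.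
by apply: eq_bigr => i _; rewrite qE mulrDr.
Qed.

End RootSystem.

Theorem theorem1p1 (R : realType) (V : vectType R) (dot : {dot V for idfun})
    (D : root_system dot) (Dnorm : normalized D) (w w' : V -> V)
    (Ww : affine_weyl_group D w) (Ww' : affine_weyl_group D w') :
  same_orientation D w w' <->
    (exists C, irreducible_component (shi_variety D) C /\
               C (shi_point D w) /\ C (shi_point D w')) /\
    cohomology_class D (section_cocycle (shi_section D w)) =
      cohomology_class D (section_cocycle (shi_section D w')).
Proof.
have [z zE] := dual_vector D (fun i => (shi_vector D w (simple_pos D i))%:~R).
have [z' z'E] := dual_vector D (fun i => (shi_vector D w' (simple_pos D i))%:~R).
rewrite (shi_vector_section_class zE z'E).
split=> [[x xL w'E]|[[C [[CS Cirr _] [Cw Cw']]] zL]].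
  have kE (b : pos_roots D) :
      shi_point D w' b = dot x (coroot dot (val b)) + shi_point D w b.
    by rewrite w'E !ffunE shi_vector_translation.
  (* Both sides have the same pairings with simple coroots, namely the differences of the simple Shi
     coefficients. *)
  have z'zE : z' - z = x.
    apply: (@dot_simple_coroot_ext _ _ _ D) => i; rewrite dotBl zE z'E.
    by have := kE (simple_pos D i); rewrite !ffunE /= => ->; rewrite addrK.
  rewrite z'zE; split=> //; have [l ladm wl] := shi_point_admitted Dnorm Ww.
  exists (shi_subspace l); split.
    by apply: shi_subspace_component => //; exists (shi_point D w).
  split=> // b; rewrite kE wl addrA; congr (_ + _); apply/esym.
  by apply: shi_linear_form_simple_ext => i; exact: kE.
(* The component [C] is arbitrary, but it lies in one X[l], which therefore contains both Shi
   points. *)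
have [l Cl] := irreducible_sub_shi_variety Cirr CS.
have Wzw : affine_weyl_group D (translation (z' - z) \o w).
  by apply: generated_by_comp => //; exact: affine_weyl_translation.
exists (z' - z) => //; apply: (alcove_inj Ww' Wzw); rewrite !shi_vectorP //.
suff -> : shi_vector D (translation (z' - z) \o w) = shi_vector D w' by [].
apply/ffunP => b; apply/eqP; rewrite -(eqr_int R) shi_vector_translation //.
(* In X[l] the simple coordinates determine the others, so it suffices that they differ by <z' - z,
   a_i^v>. *)
apply/eqP; have := Cl _ Cw' b; have := Cl _ Cw b.
rewrite (@shi_linear_form_simple_ext _ _ _ _ (z' - z) (shi_point D w)
  (shi_point D w')) => [|i]; first by rewrite !ffunE => -> ->; rewrite addrA.
by rewrite !ffunE dotBl zE z'E subrK.
Qed.
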